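(* (Refined Markov Lemma.) Let $\mathcal X,\mathcal Y,\mathcal Z$ be finite sets, let $P_{Z|Y}$ be a conditional distribution on $\mathcal Z$ given $\mathcal Y$, and let $g:\mathbb R^+\to\mathbb R^+$ satisfy $g(\delta_0)\to0$ as $\delta_0\to0$. Then there exists a function $\delta:\mathbb R^+\to\mathbb R^+$ with $\delta(\delta_0)\to0$ as $\delta_0\to0$, and for each $\delta_0>0$ a constant $K>0$, where $K$ depends on $\delta_0$, $g$ and $P_{Z|Y}$ (and the alphabets) but not on $n$, $P_{X,Y}$, $P_{\mathbf Z}$ or $(\mathbf x,\mathbf y)$ below, and the function $\delta$ does not depend on $(\mathbf x,\mathbf y)$, $P_{X,Y}$ or $P_{\mathbf Z}$, such that the following holds. Let $X\to Y\to Z$ be a Markov chain with $P_{X,Y,Z}=P_Y P_{X|Y}P_{Z|Y}$, where $P_{X,Y}$ is any distribution on $\mathcal X\times\mathcal Y$. Let $(\mathbf x,\mathbf y)\in\mathcal T^n_{\delta_0}(P_{X,Y})$, and let $\mathbf Z\sim P_{\mathbf Z}$ be a random vector in $\mathcal Z^n$ such that (a) for some $\epsilon>0$, $\mathbb P\bigl((\mathbf y,\mathbf Z)\notin\mathcal T^n_{\delta_0}(P_{Y,Z})\bigr)\le\epsilon$; (b) for every $\mathbf z\in\mathcal T^n_{\delta_0}(P_{Y,Z}|\mathbf y)$, $$2^{-n(H(Z|Y)+g(\delta_0))}\le P_{\mathbf Z}(\mathbf z)\le 2^{-n(H(Z|Y)-g(\delta_0))}.$$ Then $$\mathbb P\bigl((\mathbf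 x,\mathbf y,\mathbf Z)\notin\mathcal T^n_{\delta(\delta_0)}(P_{X,Y,Z})\bigr)\le 2|\mathcal X||\mathcal Y||\mathcal Z|e^{-nK}+\epsilon.$$
   Context: $\mathbb R^+$ is the set of non-negative reals. For a sequence $\mathbf x\in\mathcal X^n$, $T_{\mathbf x}$ denotes its type (empirical distribution), and similarly $T_{\mathbf x,\mathbf y}$, $T_{\mathbf x,\mathbf y,\mathbf z}$ denote joint types. For a distribution $P_X$ and $\epsilon>0$, $\mathcal T^n_\epsilon(P_X)=\{\mathbf x\in\mathcal X^n:\|T_{\mathbf x}-P_X\|_\infty\le\epsilon\}$, where $\|\cdot\|_\infty$ is the $l_\infty$ norm; the same definition applies to joint distributions of pairs and triples. For $\mathbf y\in\mathcal Y^n$, $\mathcal T^n_\epsilon(P_{Y,Z}|\mathbf y)=\{\mathbf z\in\mathcal Z^n:\|T_{\mathbf y,\mathbf z}-P_{Y,Z}\|_\infty\le\epsilon\}$. $P_{Y,Z}=P_YP_{Z|Y}$ is the marginal of $P_{X,Y,Z}$, and $H(Z|Y)$ is the conditional entropy (base 2) under $P_{Y,Z}$. *)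

(* Defs.v *)
From HB Require Import structures.
From mathcomp Require Import all_boot all_order all_algebra.
From mathcomp Require Import all_classical all_reals all_analysis.

Set Implicit Arguments.
Unset Strict Implicit.
Unset Printing Implicit Defensive.

Import Order.TTheory GRing.Theory Num.Theory.
Import numFieldNormedType.Exports.

Local Open Scope ring_scope.

Definition is_dist (R : realType) (A : finType) (P : A -> R) : Prop :=
  (forall a, 0 <= P a) /\ \sum_a P a = 1.

(* [W b] is the conditional distribution given [b]; it is required to be a
   distribution for every [b], including those of probability zero. *)
Definition is_cond_dist (R : realType) (B A : finType) (W : B -> A -> R) : Prop :=
  forall b, is_dist (W b).

Definition Pr (R : realType) (A : finType) (P : A -> R) (E : {set A}) : R :=
  \sum_(a in E) P a.

Definition linf_norm (R : realType) (A : finType) (f : A -> R) : R :=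
  \big[Num.max/0]_(a : A) `|f a|.

Definition pair_seq (n : nat) (A B : finType)
    (a : {ffun 'I_n -> A}) (b : {ffun 'I_n -> B}) : {ffun 'I_n -> A * B} :=
  [ffun i => (a i, b i)].

Definition triple_seq (n : nat) (A B C : finType)
    (a : {ffun 'I_n -> A}) (b : {ffun 'I_n -> B}) (c : {ffun 'I_n -> C}) :
    {ffun 'I_n -> A * B * C} :=
  [ffun i => (a i, b i, c i)].

(* Empirical distribution; meaningful for [0 < n] only. *)
Definition emp_dist (R : realType) (n : nat) (A : finType)
    (s : {ffun 'I_n -> A}) (a : A) : R :=
  #|[set i | s i == a]|%:R / n%:R.

Definition typ_set (R : realType) (n : nat) (A : finType) (eps : R)
    (P : A -> R) : {set {ffun 'I_n -> A}} :=
  [set s | linf_norm (fun a => emp_dist R s a - P a) <= eps].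

Definition cond_typ_set (R : realType) (n : nat) (B A : finType) (eps : R)
    (P : B * A -> R) (b : {ffun 'I_n -> B}) : {set {ffun 'I_n -> A}} :=
  [set s | pair_seq b s \in typ_set n eps P].

Definition marg1 (R : realType) (A B : finType) (P : A * B -> R) (a : A) : R :=
  \sum_(b : B) P (a, b).

Definition marg2 (R : realType) (A B : finType) (P : A * B -> R) (b : B) : R :=
  \sum_(a : A) P (a, b).

Definition marg23 (R : realType) (A B C : finType) (P : A * B * C -> R)
    (p : B * C) : R :=
  \sum_(a : A) P (a, p.1, p.2).

(* P(a | b); equal to 0 by convention when [b] has probability 0. *)
Definition cond1 (R : realType) (A B : finType) (P : A * B -> R)
    (a : A) (b : B) : R :=
  P (a, b) / marg2 P b.

(* Joint law P_Y P_{X|Y} P_{Z|Y} of the Markov chain X -> Y -> Z. *)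
Definition markov_joint (R : realType) (X Y Z : finType) (PXY : X * Y -> R)
    (W : Y -> Z -> R) (t : X * Y * Z) : R :=
  marg2 PXY t.1.2 * cond1 PXY t.1.1 t.1.2 * W t.1.2 t.2.

Definition log2 (R : realType) (t : R) : R := ln t / ln 2.

(* H(A | B) for (B, A) ~ P.  Null terms vanish whatever the value of the
   logarithm, which implements the convention 0 log 0 = 0. *)
Definition cond_entropy (R : realType) (B A : finType) (P : B * A -> R) : R :=
  - \sum_(b : B) \sum_(a : A) P (b, a) * log2 (P (b, a) / marg1 P b).

(* Main.v *)
(* On typical z, hypothesis (b) bounds P_Z(z) by 2^(n g(t)) times 2^(-n H(Z|Y)),
   and the latter is, up to a factor exponential in n with small rate, the
   probability of z under a memoryless channel fed with y.  Under that channel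
   the joint type of (x, y, Z) concentrates by Chernoff's bound, so it suffices
   to let delta(t) exceed the square root of the total rate lost.  The channel
   used is not W but W' = (1 - t) W + t / |Z|: a typical z may contain a few
   pairs (b, c) with W(c | b) = 0, for which log W is infinite, whereas
   |log W'| <= log (|Z| / t) costs only O(t log (1 / t)) per letter. *)
Require Import Defs.
From HB Require Import structures.
From mathcomp Require Import all_boot all_order all_algebra.
From mathcomp Require Import all_classical all_reals all_analysis.
From mathcomp Require Import ring lra.

Set Implicit Arguments.
Unset Strict Implicit.
Unset Printing Implicit Defensive.

Import Order.TTheory GRing.Theory Num.Theory.
Import numFieldNormedType.Exports.

Local Open Scope ring_scope.

(** * Elementary bounds for the exponential and the logarithm *)

(** Since [1 - t <= expR (- t)], it remains to see that [(1 + t + 2 t^2) (1 - t) = 1 + t^2 (1 - 2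
    t)] is at least 1. *)
Lemma expR_le_quadratic (R : realType) (t : R) :
  t <= 2^-1 -> expR t <= 1 + t + 2 * t ^+ 2.
Proof.
move=> t_le; have h : expR t * (1 - t) <= 1.
  rewrite -[leRHS](expRxMexpNx_1 t) ler_wpM2l ?expR_ge0 //.
  exact: expR_ge1Dx.
have t1 : 0 < 1 - t by lra.
rewrite -(ler_pM2r t1); apply: le_trans h _.
have -> : (1 + t + 2 * t ^+ 2) * (1 - t) = 1 + t ^+ 2 * (1 - 2 * t) by ring.
by rewrite lerDl mulr_ge0 ?sqr_ge0 //; lra.
Qed.

(** Write [ln (1 / t)] as [2 ln (1 / sqrt t)] and apply [ln u < u]; the resulting bound visibly
    tends to 0 with [t]. *)
Lemma mul_ln_inv_le (R : realType) (t m : R) :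
  0 < t -> 0 < m -> t * ln (m / t) <= t * m + 2 * Num.sqrt t.
Proof.
move=> t0 m0; have s0 : 0 < Num.sqrt t by rewrite sqrtr_gt0.
have tE : t = Num.sqrt t ^+ 2 by rewrite sqr_sqrtr // ltW.
rewrite lnM ?posrE ?invr_gt0 // mulrDr lerD //.
  by rewrite ler_wpM2l ?(ltW t0) //; exact/ltW/ln_sublinear.
have -> : ln t^-1 = 2 * ln (Num.sqrt t)^-1.
  by rewrite {1}tE -exprVn lnXn ?invr_gt0 // mulr_natl.
have : ln (Num.sqrt t)^-1 <= (Num.sqrt t)^-1.
  by apply/ltW/ln_sublinear; rewrite invr_gt0.
move=> /(ler_wpM2l (ltW t0)); have -> : t * (Num.sqrt t)^-1 = Num.sqrt t.
  by rewrite {1}tE expr2 mulfK // gt_eqF.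
by move=> h; lra.
Qed.

Lemma ln_one_sub_ge (R : realType) (t : R) :
  0 <= t -> t <= 2^-1 -> - (2 * t) <= ln (1 - t).
Proof.
move=> t0 t2; have t1 : 0 < 1 - t by lra.
have := @le_ln1Dx R ((1 - t)^-1 - 1).
have i1 : 1 <= (1 - t)^-1 by rewrite invf_ge1 //; lra.
rewrite addrCA subrr addr0 lnV ?posrE // => /(_ ltac:(lra)).
have : (1 - t)^-1 - 1 <= 2 * t.
  rewrite lerBlDr -(ler_pM2r t1) mulVf ?gt_eqF //.
  by nra.
by lra.
Qed.

(** * Finite distributions, types and typical sets *)

Section Dist.
Variables (R : realType) (A : finType).
Implicit Types (P : A -> R).

Lemma dist_le1 P a : is_dist P -> P a <= 1.
Proof. by move=> [P0 <-]; rewrite (bigD1 a) //= lerDl sumr_ge0. Qed.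

Lemma le_Pr P (E F : {set A}) :
  (forall a, 0 <= P a) -> E \subset F -> Pr P E <= Pr P F.
Proof.
move=> P0 /fintype.subsetP EF; rewrite /Pr.
rewrite [leRHS]big_mkcond [leLHS]big_mkcond /=.
apply: ler_sum => a _; case: ifPn => [/EF -> //|_].
by case: ifP.
Qed.

Lemma Pr_setU_le P (E F : {set A}) :
  (forall a, 0 <= P a) -> Pr P (E :|: F) <= Pr P E + Pr P F.
Proof.
move=> P0; rewrite /Pr [leLHS]big_mkcond.
rewrite [X in X + _]big_mkcond [X in _ + X]big_mkcond -big_split /=.
apply: ler_sum => a _; rewrite inE.
by have := P0 a; case: (a \in E); case: (a \in F) => /=; lra.
Qed.

Lemma Pr_bigcup_le (I : finType) P (E : I -> {set A}) :
  (forall a, 0 <= P a) -> Pr P (\bigcup_i E i) <= \sum_i Pr P (E i).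
Proof.
move=> P0; elim/big_ind2: _ => [|F s G u hF hG|//].
  by rewrite /Pr big_set0.
exact: le_trans (Pr_setU_le _ _ P0) (lerD hF hG).
Qed.

Variables (n : nat).
Implicit Types (s : {ffun 'I_n -> A}).
Hypothesis n_gt0 : (0 < n)%N.

Lemma sum_emp_dist (F : A -> R) s :
  \sum_i F (s i) = n%:R * \sum_a emp_dist R s a * F a.
Proof.
rewrite (partition_big s predT) //= mulr_sumr; apply: eq_bigr => a _.
rewrite (eq_bigr (fun=> F a)) => [|i /eqP -> //].
rewrite /emp_dist mulrA mulrCA mulfV ?mulr1 ?pnatr_eq0 -?lt0n //.
by rewrite sumr_const mulr_natl cardsE.
Qed.

Lemma emp_distE s a : n%:R * emp_dist R s a = \sum_i (s i == a)%:R.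
Proof.
rewrite (sum_emp_dist (fun b => (b == a)%:R)) (bigD1 a) //= eqxx mulr1.
by rewrite big1 ?addr0 // => b /negPf ->; rewrite mulr0.
Qed.

Lemma emp_dist_ge0 s a : 0 <= emp_dist R s a.
Proof. by rewrite mulr_ge0 ?invr_ge0 ?ler0n. Qed.

Lemma emp_dist_le1 s a : emp_dist R s a <= 1.
Proof.
rewrite /emp_dist ler_pdivrMr ?ltr0n // mul1r ler_nat.
by apply: leq_trans (max_card _) _; rewrite card_ord.
Qed.

(** The maximum in [linf_norm] starts at 0, hence the assumption [0 <= eps]. *)
Lemma typ_setP (eps : R) P s : 0 <= eps ->
  reflect (forall a, `|emp_dist R s a - P a| <= eps) (s \in typ_set n eps P).
Proof.
move=> eps0; rewrite inE /linf_norm; apply: (iffP (bigmax_leP _ _ _ _)).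
  by move=> [_ h] a; exact: h.
by move=> h; split.
Qed.

(** Disposes of the values of [t] for which [delta t] is at least 1. *)
Lemma typ_set_ge1 (eps : R) P s :
  is_dist P -> 1 <= eps -> s \in typ_set n eps P.
Proof.
move=> Pd eps1; apply/typ_setP => [|a]; first by lra.
have := dist_le1 a Pd; have := Pd.1 a.
have := emp_dist_ge0 s a; have := emp_dist_le1 s a.
by rewrite ler_norml => *; apply/andP; split; lra.
Qed.

End Dist.

(** * Chernoff bound for independent, bounded, centred variables *)

Section Chernoff.
Variables (R : realType) (n : nat) (Z : finType) (Q f : 'I_n -> Z -> R).
Hypothesis Q_dist : forall i, is_dist (Q i).
Hypothesis f_le1 : forall i c, `|f i c| <= 1.
Hypothesis f_mean : forall i, \sum_c Q i c * f i c = 0.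

Definition prod_dist (z : {ffun 'I_n -> Z}) : R := \prod_i Q i (z i).

Lemma prod_dist_ge0 z : 0 <= prod_dist z.
Proof. by apply: prodr_ge0 => i _; exact: (Q_dist i).1. Qed.

(** By independence the moment generating function factors over the positions. In each factor the
    linear term vanishes by [f_mean], leaving at most [1 + 2 l^2 <= expR (2 l^2)]. *)
Lemma prod_dist_mgf (l : R) : 0 <= l -> l <= 2^-1 ->
  \sum_z prod_dist z * expR (l * \sum_i f i (z i))
    <= expR (n%:R * (2 * l ^+ 2)).
Proof.
move=> l0 l1.
under eq_bigr do rewrite mulr_sumr expR_sum -big_split /=.
rewrite -(bigA_distr_bigA (fun i c => Q i c * expR (l * f i c))) /=.
apply: (@le_trans _ _ (\prod_(i < n) expR (2 * l ^+ 2))); last first.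
  by rewrite prodr_const card_ord -expRM_natl.
apply: ler_prod => i _; have [Q0 Q1] := Q_dist i; apply/andP; split.
  by apply: sumr_ge0 => c _; rewrite mulr_ge0 ?expR_ge0.
apply: le_trans (expR_ge1Dx _).
apply: (@le_trans _ _
  (\sum_c (Q i c + l * (Q i c * f i c) + Q i c * (2 * l ^+ 2)))).
  apply: ler_sum => c _.
  have -> : Q i c + l * (Q i c * f i c) + Q i c * (2 * l ^+ 2) =
    Q i c * (1 + l * f i c + 2 * l ^+ 2) by ring.
  rewrite ler_wpM2l //.
  have := f_le1 i c; rewrite ler_norml => /andP[fm fp].
  apply: le_trans (expR_le_quadratic _) _; first by nra.
  rewrite lerD2l ler_wpM2l // exprMn ler_piMr ?sqr_ge0 //.
  by nra.
by rewrite !big_split /= -mulr_sumr f_mean -mulr_suml Q1 mulr0 addr0 mul1r.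
Qed.

Lemma chernoff_upper (th : R) : 0 <= th -> th <= 2 ->
  Pr prod_dist [set z : {ffun 'I_n -> Z} | n%:R * th < \sum_i f i (z i)]
    <= expR (- (n%:R * (th ^+ 2 / 8))).
Proof.
(* The minimiser of [2 l^2 - l th], with minimum [- th^2 / 8]; [th <= 2] gives the [l <= 1/2]
   required by [prod_dist_mgf]. *)
move=> th0 th2; set l := th / 4.
have l0 : 0 <= l by rewrite /l; lra.
apply: (@le_trans _ _ (\sum_z prod_dist z *
    expR (l * \sum_i f i (z i)) * expR (- (l * (n%:R * th))))).
  rewrite /Pr big_mkcond /=; apply: ler_sum => z _; rewrite inE.
  have p0 := prod_dist_ge0 z; case: ifP => [h|_].
    rewrite -mulrA ler_peMr // -expRD.
    apply: le_trans (expR_ge1Dx _); rewrite lerDl subr_ge0.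
    by rewrite ler_wpM2l // ltW.
  by rewrite !mulr_ge0 ?expR_ge0.
rewrite -mulr_suml; apply: (@le_trans _ _
  (expR (n%:R * (2 * l ^+ 2)) * expR (- (l * (n%:R * th))))).
  by rewrite ler_wpM2r ?expR_ge0 // prod_dist_mgf // /l; lra.
by rewrite -expRD ler_expR /l le_eqVlt; apply/orP; left; apply/eqP; field.
Qed.

End Chernoff.

Lemma chernoff (R : realType) (n : nat) (Z : finType) (Q f : 'I_n -> Z -> R)
    (th : R) :
  (forall i, is_dist (Q i)) -> (forall i c, `|f i c| <= 1) ->
  (forall i, \sum_c Q i c * f i c = 0) -> 0 <= th -> th <= 2 ->
  Pr (prod_dist Q) [set z : {ffun 'I_n -> Z} | n%:R * th < `|\sum_i f i (z i)|]
    <= 2 * expR (- (n%:R * (th ^+ 2 / 8))).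
Proof.
move=> Qd f1 f0 th0 th2; have p0 := prod_dist_ge0 Qd.
have up := chernoff_upper Qd f1 f0 th0 th2.
have dn : Pr (prod_dist Q)
    [set z : {ffun 'I_n -> Z} | n%:R * th < \sum_i - f i (z i)]
    <= expR (- (n%:R * (th ^+ 2 / 8))).
  apply: (@chernoff_upper _ _ _ _ (fun i c => - f i c)) => //.
    by move=> i c; rewrite normrN.
  by move=> i; under eq_bigr do rewrite mulrN; rewrite sumrN f0 oppr0.
have -> : 2 * expR (- (n%:R * (th ^+ 2 / 8))) = expR (- (n%:R * (th ^+ 2 / 8)))
   + expR (- (n%:R * (th ^+ 2 / 8))) by ring.
apply: le_trans (lerD up dn).
apply: le_trans (Pr_setU_le _ _ p0); apply: le_Pr => //.
apply/fintype.subsetP => z; rewrite !inE sumrN ltr_normr.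
by case/orP => ->; rewrite ?orbT.
Qed.

(** * The smoothed channel and its log-likelihood *)

Section Channel.
Variables (R : realType) (Y Z : finType) (W : Y -> Z -> R).
Hypothesis W_dist : is_cond_dist W.

Definition smooth (t : R) (b : Y) (c : Z) : R := (1 - t) * W b c + t / #|Z|%:R.

Lemma card_gt0_output (b : Y) : 0 < #|Z|%:R :> R.
Proof.
rewrite ltr0n lt0n; apply/eqP => Z0; have [_] := W_dist b.
rewrite big1 => [|c _]; first by move/eqP; rewrite eq_sym oner_eq0.
by have := card0_eq Z0 c; rewrite inE.
Qed.

Lemma smooth_dist t b : 0 <= t -> t <= 1 -> is_dist (smooth t b).
Proof.
move=> t0 t1; have Z0 := card_gt0_output b; have [W0 W1] := W_dist b; split.
  by move=> c; rewrite addr_ge0 ?mulr_ge0 ?subr_ge0 ?divr_ge0 // ltW.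
rewrite /smooth big_split /= -mulr_sumr W1 sumr_const.
rewrite -(mulr_natr (t / _)) divfK ?gt_eqF //.
by rewrite mulr1 subrK.
Qed.

Lemma smooth_sub_le t b c : 0 <= t -> t <= 1 -> `|smooth t b c - W b c| <= t.
Proof.
move=> t0 t1; have Z0 := card_gt0_output b; have [W0 _] := W_dist b.
have -> : smooth t b c - W b c = t * (#|Z|%:R^-1 - W b c).
  by rewrite /smooth; ring.
rewrite normrM (ger0_norm t0) ler_piMr //.
have i0 : 0 <= #|Z|%:R^-1 :> R by rewrite invr_ge0 ltW.
have i1 : #|Z|%:R^-1 <= 1 :> R by rewrite invf_le1 // ler1n -(ltr0n R).
have := W0 c; have := dist_le1 c (W_dist b).
by rewrite ler_norml => *; apply/andP; split; lra.
Qed.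

(* Upper bound for [2 t + |Y| |Z| t ln (|Z| / t)], in nats per letter: [2 t]
   pays for [ln (1 - t)], the rest for the deviation of the type of (y, z)
   from its mean; [ln] is eliminated by [mul_ln_inv_le]. *)
Definition smoothing_cost (t : R) : R :=
  2 * t + #|Y|%:R * #|Z|%:R * (t * #|Z|%:R + 2 * Num.sqrt t).

Lemma smoothing_cost_ge0 t : 0 <= t -> 0 <= smoothing_cost t.
Proof.
by move=> t0; rewrite /smoothing_cost !(addr_ge0, mulr_ge0) ?sqrtr_ge0 ?ler0n.
Qed.

Variables (t : R).
Hypotheses (t_gt0 : 0 < t) (t_le : t <= 2^-1).

Let t_ge0 : 0 <= t. Proof. exact: ltW. Qed.
Let t_le1 : t <= 1. Proof. by move: t_le; lra. Qed.

Lemma smooth_ge b c : t / #|Z|%:R <= smooth t b c.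
Proof.
by rewrite /smooth lerDr mulr_ge0 ?subr_ge0 //; exact: (W_dist b).1.
Qed.

Lemma smooth_gt0 b c : 0 < smooth t b c.
Proof.
by apply: lt_le_trans (smooth_ge b c); rewrite divr_gt0 // (card_gt0_output b).
Qed.

(** Entries of the smoothed channel lie between [t / |Z|] and 1; this uniform bound is what
    smoothing provides. *)
Lemma norm_ln_smooth_le b c : `|ln (smooth t b c)| <= ln (#|Z|%:R / t).
Proof.
have Z0 := card_gt0_output b; have s0 := smooth_gt0 b c.
rewrite ler0_norm; last exact/ln_le0/dist_le1/smooth_dist.
rewrite -[_ / t]invrK invf_div lnV ?posrE ?divr_gt0 // lerN2.
by rewrite ler_ln ?posrE ?divr_gt0 // smooth_ge.
Qed.

Lemma ln_smooth_ge b c : 0 < W b c -> ln (W b c) - 2 * t <= ln (smooth t b c).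
Proof.
move=> W0; have Z0 := card_gt0_output b.
have t1 : 0 < 1 - t by move: t_le; lra.
have := ln_one_sub_ge t_ge0 t_le.
suff : ln ((1 - t) * W b c) <= ln (smooth t b c) by rewrite lnM ?posrE //; lra.
rewrite ler_ln ?posrE ?smooth_gt0 ?mulr_gt0 //.
by rewrite /smooth lerDl divr_ge0 // ltW.
Qed.

Variables (n : nat) (n_gt0 : (0 < n)%N) (PY : Y -> R).
Hypothesis PY_dist : is_dist PY.

(** The log-likelihood of [z] is [n] times the average of [ln (smooth t)] under the type of
    [(y, z)]. Passing from the type to [PY W] costs at most [t ln (|Z| / t)] per pair of letters, by
    typicality; passing from [ln (smooth t)] to [ln W] costs at most [2 t] on average. *)
Lemma prod_smooth_ge (y : {ffun 'I_n -> Y}) (z : {ffun 'I_n -> Z}) :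
  pair_seq y z \in typ_set n t (fun p => PY p.1 * W p.1 p.2) ->
  expR (n%:R * (\sum_p PY p.1 * W p.1 p.2 * ln (W p.1 p.2) - smoothing_cost t))
    <= prod_dist (fun i => smooth t (y i)) z.
Proof.
move=> /(typ_setP _ _ t_ge0) typ.
have -> : prod_dist (fun i => smooth t (y i)) z =
    expR (n%:R * \sum_p emp_dist R (pair_seq y z) p * ln (smooth t p.1 p.2)).
  rewrite -(sum_emp_dist n_gt0 (fun p => ln (smooth t p.1 p.2))) expR_sum.
  apply: eq_bigr => i _; rewrite ffunE /= lnK // posrE.
  exact: smooth_gt0.
rewrite ler_expR ler_wpM2l ?ler0n //.
(* [card_gt0_output] asks for an input letter; [0 < n] supplies the first one of [y]. *)
have [b0 _] : exists b : Y, True.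
  by exists (y (Ordinal n_gt0)).
have PW1 : \sum_(p : Y * Z) PY p.1 * W p.1 p.2 = 1.
  rewrite -(pair_bigA _ (fun b c => PY b * W b c)) /= -PY_dist.2.
  by apply: eq_bigr => b _; rewrite -mulr_sumr (W_dist b).2 mulr1.
set M := ln (#|Z|%:R / t).
have cost : \sum_(p : Y * Z) (2 * t * (PY p.1 * W p.1 p.2) + t * M)
    <= smoothing_cost t.
  rewrite big_split /= -mulr_sumr PW1 mulr1 sumr_const card_prod lerD2l.
  rewrite -(mulr_natl (t * M)) natrM ler_wpM2l ?mulr_ge0 ?ler0n //.
  exact: mul_ln_inv_le (card_gt0_output b0).
rewrite lerBlDr; apply: le_trans (lerD (lexx _) cost).
rewrite -big_split /=; apply: ler_sum => -[b c] _ /=.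
have L := norm_ln_smooth_le b c; have := typ (b, c) => /=.
set T := emp_dist _ _ _ => TP.
have dev : - (t * M) <= (T - PY b * W b c) * ln (smooth t b c).
  have : `|(T - PY b * W b c) * ln (smooth t b c)| <= t * M.
    by rewrite normrM ler_pM.
  by rewrite ler_norml => /andP[].
suff : PY b * W b c * ln (W b c) <=
    PY b * W b c * ln (smooth t b c) + 2 * t * (PY b * W b c) by lra.
(* When [W b c = 0], every term carries this factor, whatever the value of [ln 0]. *)
have := (W_dist b).1 c; rewrite le_eqVlt => /predU1P[<-|W0].
  by rewrite !(mulr0, mul0r) addr0.
have PW0 : 0 <= PY b * W b c by rewrite mulr_ge0 ?PY_dist.1 // ltW.
have := ler_wpM2l PW0 (ln_smooth_ge W0).
by lra.
Qed.

End Channel.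

(** * The law of the Markov chain and the deviation of the joint type *)

Section Markov.
Variables (R : realType) (X Y Z : finType) (W : Y -> Z -> R).
Hypothesis W_dist : is_cond_dist W.
Variable PXY : X * Y -> R.
Hypothesis PXY_dist : is_dist PXY.

(** If [b] has mass 0, then [PXY (a, b)] is a term of a null sum of non-negative reals, so both
    sides vanish. *)
Lemma markov_jointE a b c : markov_joint PXY W (a, b, c) = PXY (a, b) * W b c.
Proof.
rewrite /markov_joint /cond1 /=; congr (_ * _).
have [m0|m0] := eqVneq (marg2 PXY b) 0; last by rewrite mulrC divfK.
rewrite m0 mul0r; apply/esym/eqP; rewrite eq_le PXY_dist.1 andbT.
by rewrite -m0 /marg2 (bigD1 a) //= lerDl sumr_ge0 // => *; exact: PXY_dist.1.
Qed.

Lemma markov_joint_dist : is_dist (markov_joint PXY W).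
Proof.
split=> [[[a b] c]|].
  by rewrite markov_jointE mulr_ge0 ?PXY_dist.1 //; exact: (W_dist b).1.
rewrite -(pair_bigA _ (fun p c => markov_joint PXY W (p, c))) /= -PXY_dist.2.
apply: eq_bigr => -[a b] _; under eq_bigr do rewrite markov_jointE.
by rewrite -mulr_sumr (W_dist b).2 mulr1.
Qed.

Lemma marg2_dist : is_dist (marg2 PXY).
Proof.
split=> [b|]; first by apply: sumr_ge0 => *; exact: PXY_dist.1.
rewrite -PXY_dist.2 /marg2 exchange_big /=.
by rewrite (pair_bigA _ (fun a b => PXY (a, b))); apply: eq_bigr => -[].
Qed.

Lemma marg23_markov :
  marg23 (markov_joint PXY W) = fun p => marg2 PXY p.1 * W p.1 p.2.
Proof.
apply/funext => -[b c]; rewrite /marg23 /marg2 /= mulr_suml.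
by apply: eq_bigr => a _; rewrite markov_jointE.
Qed.

(** The factor [ln 2] converts bits to nats, the unit of [prod_smooth_ge]. *)
Lemma cond_entropy_markov :
  cond_entropy (marg23 (markov_joint PXY W)) * ln 2 =
  - \sum_p marg2 PXY p.1 * W p.1 p.2 * ln (W p.1 p.2).
Proof.
rewrite marg23_markov /cond_entropy mulNr; congr (- _).
rewrite pair_bigA /= mulr_suml; apply: eq_bigr => -[b c] _ /=.
have -> : marg1 (fun p => marg2 PXY p.1 * W p.1 p.2) b = marg2 PXY b.
  by rewrite /marg1 /= -mulr_sumr (W_dist b).2 mulr1.
have [->|m0] := eqVneq (marg2 PXY b) 0; first by rewrite !mul0r.
rewrite [marg2 _ _ * _ / _]mulrC mulKf // /log2 !mulrA divfK //.
by rewrite gt_eqF // ln_gt0 // ltr1n.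
Qed.

Variables (n : nat) (n_gt0 : (0 < n)%N) (t : R).
Hypotheses (t_gt0 : 0 < t) (t_le : t <= 2^-1).
Variables (x : {ffun 'I_n -> X}) (y : {ffun 'I_n -> Y}).
Hypothesis xy_typ : pair_seq x y \in typ_set n t PXY.

Let t_ge0 : 0 <= t. Proof. exact: ltW. Qed.
Let t_le1 : t <= 1. Proof. by move: t_le; lra. Qed.

(** Centred when [c] has law [smooth W t (y i)]: the first factor is 0 unless [y i = p.1.2], and
    then the second one has mean 0. *)
Definition centered_indicator (p : X * Y * Z) (i : 'I_n) (c : Z) : R :=
  ((x i, y i) == p.1)%:R * ((c == p.2)%:R - smooth W t p.1.2 p.2).

Lemma sum_centered_indicator p (z : {ffun 'I_n -> Z}) :
  \sum_i centered_indicator p i (z i) =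
  n%:R * (emp_dist R (triple_seq x y z) p
          - emp_dist R (pair_seq x y) p.1 * smooth W t p.1.2 p.2).
Proof.
rewrite mulrBr [n%:R * (_ * smooth _ _ _ _)]mulrA !emp_distE // mulr_suml -sumrB.
apply: eq_bigr => i _.
rewrite /centered_indicator mulrBr !ffunE; congr (_ - _).
by case: p => p c; rewrite xpair_eqE /= -natrM mulnb.
Qed.

(** With [T3], [T2] the types of [(x, y, z)] and [(x, y)], and [W'] the smoothed channel, [T3 - PXY
    W = (T3 - T2 W') + T2 (W' - W) + (T2 - PXY) W]. The last two terms are at most [t] each, by
    smoothing and by [xy_typ]. *)
Lemma atypical_deviation (th : R) z :
  0 <= th ->
  triple_seq x y z \notin typ_set n (th + 2 * t) (markov_joint PXY W) ->
  exists p, n%:R * th < `|\sum_i centered_indicator p i (z i)|.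
Proof.
move=> th0 /negP bad; apply: contrapT => small; apply: bad.
apply/typ_setP => [|[[a b] c]]; first by rewrite addr_ge0 ?mulr_ge0.
have : `|\sum_i centered_indicator (a, b, c) i (z i)| <= n%:R * th.
  by rewrite leNgt; apply/negP => h; apply: small; exists (a, b, c).
rewrite sum_centered_indicator normrM normr_nat.
rewrite ler_pM2l ?ltr0n //= markov_jointE.
have /(typ_setP _ _ t_ge0)/(_ (a, b)) := xy_typ.
have := smooth_sub_le W_dist b c t_ge0 t_le1.
have := emp_dist_ge0 R (pair_seq x y) (a, b).
have := emp_dist_le1 R n_gt0 (pair_seq x y) (a, b).
have := (W_dist b).1 c; have := dist_le1 c (W_dist b).
set T3 := emp_dist _ _ (a, b, c); set T2 := emp_dist _ _ (a, b).
rewrite !ler_norml => W1 W0 T1 T0 /andP[s1 s2] /andP[u1 u2] /andP[v1 v2].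
by apply/andP; split; nra.
Qed.

(** Union bound over the [|X| |Y| |Z|] triples, with the two-sided [chernoff] for each. *)
Lemma atypical_prob_le (th : R) : 0 <= th -> th <= 2 ->
  Pr (prod_dist (fun i => smooth W t (y i)))
     [set z | triple_seq x y z
        \notin typ_set n (th + 2 * t) (markov_joint PXY W)]
  <= 2 * #|X|%:R * #|Y|%:R * #|Z|%:R * expR (- (n%:R * (th ^+ 2 / 8))).
Proof.
move=> th0 th2; have Qd i : is_dist (smooth W t (y i)) by exact: smooth_dist.
pose dev p := [set z : {ffun 'I_n -> Z} |
  n%:R * th < `|\sum_i centered_indicator p i (z i)|].
have p0 := prod_dist_ge0 Qd.
apply: (@le_trans _ _
  (Pr (prod_dist (fun i => smooth W t (y i))) (\bigcup_p dev p))).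
  apply: le_Pr => //; apply/fintype.subsetP => z; rewrite inE => bad.
  have [p hp] := atypical_deviation th0 bad.
  by apply/bigcupP; exists p => //; rewrite inE.
apply: le_trans (Pr_bigcup_le _ p0) _.
apply: (@le_trans _ _
  (\sum_(p : X * Y * Z) 2 * expR (- (n%:R * (th ^+ 2 / 8))))); last first.
  rewrite sumr_const !card_prod -(mulr_natr (2 * expR _)) !natrM.
  rewrite le_eqVlt; apply/orP; left.
  by apply/eqP; ring.
apply: ler_sum => -[[a b] c] _; apply: chernoff => // i.
  move=> c'; rewrite /centered_indicator /= normrM.
  have S := smooth_dist W_dist b t_ge0 t_le1.
  have := S.1 c; have := dist_le1 c S.
  rewrite normr_nat; case: (_ == _); rewrite ?mul0r ?ler01 // mul1r.
  by rewrite ler_norml => ? ?; apply/andP; case: (_ == _) => /=; split; lra.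
rewrite /centered_indicator /= xpair_eqE.
under eq_bigr do rewrite mulrCA.
rewrite -mulr_sumr; have [->|] := eqVneq (y i) b; last by rewrite andbF mul0r.
under eq_bigr do rewrite mulrBr.
rewrite sumrB -mulr_suml (smooth_dist W_dist b t_ge0 t_le1).2 mul1r.
rewrite (bigD1 c) //= eqxx mulr1 big1 ?addr0 ?subrr ?mulr0 //.
by move=> c' /negPf ->; rewrite mulr0.
Qed.

End Markov.

(** * Choice of [delta] and [K], and change of measure from [PZ] to the smoothed channel *)

Local Open Scope classical_set_scope.

Theorem lemma8 (R : realType) (X Y Z : finType) (W : Y -> Z -> R)
    (W_dist : is_cond_dist W)
    (g : R -> R) (g_ge0 : forall t, 0 <= t -> 0 <= g t)
    (g_lim : g t @[t --> 0^'+] --> (0 : R)) :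
  exists delta : R -> R,
    [/\ forall t, 0 <= t -> 0 <= delta t,
        delta t @[t --> 0^'+] --> (0 : R)
      & forall d0 : R, 0 < d0 ->
        exists K : R, 0 < K /\
        forall (PXY : X * Y -> R) (n : nat)
               (x : {ffun 'I_n -> X}) (y : {ffun 'I_n -> Y})
               (PZ : {ffun 'I_n -> Z} -> R) (eps : R),
          is_dist PXY -> (0 < n)%N ->
          pair_seq x y \in typ_set n d0 PXY ->
          is_dist PZ -> 0 < eps ->
          Pr PZ [set z | pair_seq y z
                   \notin typ_set n d0 (marg23 (markov_joint PXY W))] <= eps ->
          (forall z : {ffun 'I_n -> Z},
             z \in cond_typ_set d0 (marg23 (markov_joint PXY W)) y ->
             2 `^ (- (n%:R *
                 (cond_entropy (marg23 (markov_joint PXY W)) + g d0))) <= PZ z /\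
             PZ z <= 2 `^ (- (n%:R *
                 (cond_entropy (marg23 (markov_joint PXY W)) - g d0)))) ->
          Pr PZ [set z | triple_seq x y z
                   \notin typ_set n (delta d0) (markov_joint PXY W)]
            <= 2 * #|X|%:R * #|Y|%:R * #|Z|%:R * expR (- (n%:R * K)) + eps].
Proof.
(* Total rate lost, in nats per letter: [g t * ln 2] from hypothesis (b), the rest from
   [prod_smooth_ge]. *)
pose gam t : R := g t * ln 2 + smoothing_cost Y Z t.
(* Chosen so that the Chernoff exponent [theta^2 / 8] equals [gam t + t]: it absorbs the lost rate
   and leaves [K = t]. *)
pose theta t : R := Num.sqrt (8 * (gam t + t)).
have ln2_ge0 : 0 <= ln 2 :> R by rewrite ln_ge0 // ler1n.
have gam_ge0 t : 0 <= t -> 0 <= gam t.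
  by move=> t0; rewrite addr_ge0 ?smoothing_cost_ge0 ?mulr_ge0 ?g_ge0.
exists (fun t => theta t + 2 * t); split.
- by move=> t t0; rewrite addr_ge0 ?sqrtr_ge0 ?mulr_ge0.
(* [delta] is built from [g] and the identity by sums, scalings and square roots, all of which
   preserve convergence to 0. *)
- have id0 : t @[t --> 0^'+] --> (0 : R).
    by apply: cvg_at_right_filter; exact: cvg_id.
  have sqrt0 (h : R -> R) : h t @[t --> 0^'+] --> (0 : R) ->
      Num.sqrt (h t) @[t --> 0^'+] --> (0 : R).
    move=> h0; rewrite -[X in _ --> X]sqrtr0.
    by apply: (cvg_comp _ _ h0); exact: sqrt_continuous.
  have lin0 (k : R) (h : R -> R) : h t @[t --> 0^'+] --> (0 : R) ->
      k * h t @[t --> 0^'+] --> (0 : R).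
    move=> h0; rewrite -[X in _ --> X](mulr0 k).
    by apply: cvgM => //; exact: cvg_cst.
  have add0 (h k : R -> R) : h t @[t --> 0^'+] --> (0 : R) ->
      k t @[t --> 0^'+] --> (0 : R) -> h t + k t @[t --> 0^'+] --> (0 : R).
    by move=> h0 k0; rewrite -[X in _ --> X](addr0 0); exact: cvgD.
  apply: (add0); last exact: lin0.
  apply: (sqrt0); apply: (lin0); apply: (add0) => //; apply: (add0).
    by under eq_fun do rewrite mulrC; exact: lin0.
  apply: (add0); first exact: lin0.
  apply: (lin0); apply: (add0); last exact/lin0/sqrt0.
  by under eq_fun do rewrite mulrC; exact: lin0.
move=> t t0; exists t; split=> // PXY n x y PZ eps PXYd n0 xyt PZd eps0 PZe PZb.
set H := cond_entropy _ in PZb; have gt0 := gam_ge0 _ (ltW t0).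
have theta0 : 0 <= theta t by exact: sqrtr_ge0.
(* If [delta t >= 1], every sequence is typical and the event is empty. Otherwise [t] and [theta t]
   are small enough for smoothing and for Chernoff. *)
have [big|small] := leP 1 (theta t + 2 * t).
  rewrite [leLHS]big1 => [|z].
    by rewrite addr_ge0 ?mulr_ge0 ?expR_ge0 ?ler0n // ltW.
  by rewrite inE typ_set_ge1 //; exact: markov_joint_dist.
have t_half : t <= 2^-1 by lra.
have theta2 : theta t <= 2 by lra.
set bad := [set z | _]%SET; set atyp := [set z | _]%SET in PZe.
pose Q := prod_dist (fun i => smooth W t (y i)).
have Q0 z : 0 <= Q z.
  by apply: prod_dist_ge0 => i; apply: smooth_dist; rewrite ?ltW //; lra.
have PZ_le_Q z : z \notin atyp -> PZ z <= expR (n%:R * gam t) * Q z.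
  rewrite inE negbK => yz.
  have /PZb[_ /le_trans -> //] :
      z \in cond_typ_set t (marg23 (markov_joint PXY W)) y.
    by rewrite inE.
  move: yz; rewrite marg23_markov // => /prod_smooth_ge.
  move=> /(_ W_dist t0 t_half n0 (marg2_dist PXYd)).
  move=> /(ler_wpM2l (expR_ge0 (n%:R * gam t))); apply: le_trans.
  (* The two exponents agree exactly: [gam] was defined as the sum of the two losses. *)
  rewrite -expRD /powR gt_eqF ?ltr0n // ler_expR.
  rewrite mulNr -mulrA mulrBl /H cond_entropy_markov // /gam.
  by rewrite le_eqVlt; apply/orP; left; apply/eqP; ring.
(* Pointwise comparison: mass on [atyp] is charged to [PZ], and mass on the rest of [bad] to [Q]. *)
apply: (@le_trans _ _ (expR (n%:R * gam t) * Pr Q bad + Pr PZ atyp)).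
  rewrite /Pr [leLHS]big_mkcond [X in _ * X]big_mkcond.
  rewrite [X in _ + X]big_mkcond /=.
  rewrite mulr_sumr -big_split /=; apply: ler_sum => z _.
  have P0 := PZd.1 z; have := PZ_le_Q z.
  case: (z \in atyp) => /= [_|/(_ isT) h].
    have : 0 <= expR (n%:R * gam t) * Q z by rewrite mulr_ge0 ?expR_ge0.
    by case: (z \in bad) => h; lra.
  by case: (z \in bad); lra.
apply: lerD => //.
have := atypical_prob_le W_dist PXYd n0 t0 t_half xyt theta0 theta2.
move=> /(ler_wpM2l (expR_ge0 (n%:R * gam t))) /le_trans; apply.
rewrite mulrCA -expRD sqr_sqrtr; last by rewrite mulr_ge0 // addr_ge0 // ltW.
have -> : n%:R * gam t + - (n%:R * (8 * (gam t + t) / 8)) =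
  - (n%:R * t) by field.
exact: lexx.
Qed.
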